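(* Let $a,b,c,d\in\mathbb{N}$ be such that $ab\le cd$ and $a=\min(a,b,c,d)$. If $a$ divides either $c$ or $d$, then $$\begin{bmatrix}c+d\\ c\end{bmatrix}-\begin{bmatrix}a+b\\ a\end{bmatrix}\in\mathbb{N}_0[q].$$
   Context: $\mathbb{N}$ is the set of positive integers, $\mathbb{N}_0=\mathbb{N}\cup\{0\}$. $\begin{bmatrix}n\\k\end{bmatrix}=\frac{[n][n-1]\cdots[n-k+1]}{[k][k-1]\cdots[1]}$ is the Gaussian ($q$-)binomial coefficient, a polynomial in $q$, where $[n]=1+q+\cdots+q^{n-1}$. *)

(* Defs.v *)
From mathcomp Require Import all_boot all_order all_algebra.
Set Implicit Arguments.
Unset Strict Implicit.
Unset Printing Implicit Defensive.
Import GRing.Theory.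
Local Open Scope ring_scope.

Definition qint (n : nat) : {poly int} := \sum_(i < n) 'X^i.

(* [n][n-1]...[n-k+1]; the subtraction is truncated, so this is 0 for n < k. *)
Definition qffact (n k : nat) : {poly int} := \prod_(i < k) qint (n - i).

(* %/ is polynomial division; it is exact here, see qbinM. *)
Definition qbin (n k : nat) : {poly int} := qffact n k %/ qffact k k.

Lemma qint_monic (n : nat) : (0 < n)%N -> qint n \is monic.
Proof.
case: n => // n _; rewrite monicE lead_coefE /qint.
have -> : \sum_(i < n.+1) 'X^i = \poly_(i < n.+1) (1 : int).
  by rewrite poly_def; apply: eq_bigr => i _; rewrite scale1r.
by rewrite size_poly_eq ?oner_eq0 // coef_poly ltnSn.
Qed.

Lemma qintD (m n : nat) : qint (m + n) = qint m + 'X^m * qint n.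
Proof.
rewrite /qint big_split_ord /= big_distrr /=; congr (_ + _).
by apply: eq_bigr => i _; rewrite exprD.
Qed.

Lemma qffact_monic (k : nat) : qffact k k \is monic.
Proof. by apply: monic_prod => i _; rewrite qint_monic // subn_gt0. Qed.

Lemma qffactSS (n k : nat) : qffact n.+1 k.+1 = qint n.+1 * qffact n k.
Proof.
by rewrite /qffact big_ord_recl subn0; congr (_ * _); apply: eq_bigr => i _.
Qed.

Lemma qffact_small (n k : nat) : (n < k)%N -> qffact n k = 0.
Proof.
move=> nk; rewrite /qffact (bigD1 (Ordinal nk)) //= subnn.
by rewrite [qint 0]big_ord0 mul0r.
Qed.

Lemma qbinM (n k : nat) : qbin n k * qffact k k = qffact n k.
Proof.
rewrite /qbin; have [p <-] : exists p, p * qffact k k = qffact n k; last first.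
  by rewrite Pdiv.IdomainMonic.mulpK // qffact_monic.
elim: n k => [|n IHn] [|k]; try by exists 1; rewrite mul1r /qffact !big_ord0.
  by exists 0; rewrite mul0r qffact_small.
have [p Ep] := IHn k; have [r Er] := IHn k.+1.
exists (p + 'X^(k.+1) * r).
have Sn : qffact n k.+1 = qffact n k * qint (n - k) by exact: big_ord_recr.
rewrite mulrDl -mulrA Er Sn !qffactSS mulrCA Ep.
have [kn|nk] := leqP k n; last by rewrite qffact_small // !(mulr0, mul0r) addr0.
have -> : n.+1 = (k.+1 + (n - k))%N by rewrite addSn subnKC.
by rewrite qintD mulrDl [qffact n k * _]mulrC mulrA.
Qed.

(* Main.v *)
Require Import Defs.
From mathcomp Require Import all_boot all_order all_algebra.
From mathcomp Require Import zify.
Import GRing.Theory.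
Local Open Scope ring_scope.

(** The coefficient of q^n in the Gaussian binomial of a + b over a counts the
    partitions of n with at most a parts, each at most b.  So the claim
    follows from an injection, preserving size, of the partitions in the
    a x b box into those in the c x d box.

    By the symmetry of Gaussian binomials one may assume d = m a, and then
    b <= m c, so it is enough to send the box of a rows of length m (a + e)
    into the box of a + e rows of length m a, where e = c - a.  For e = 0 the
    two boxes coincide.  For e > 0, draw the staircase whose i-th row has length
    m (a + 1 - i), and let k be the last row in which the partition p reaches
    it ([ledge]).  Then p contains the rectangle of k rows of length
    m (a + 1 - k).  To the right of this rectangle is a partition r in the box
    of k rows of length m (k + (e - 1)); below it is a partition t of a - k
    rows lying strictly under the staircase.  By recursion on e, r is sent to
    a partition r' in the box of k + (e - 1) rows of length m k.  The image of
    p consists of the transposed rectangle, of a + 1 - k rows of length m k,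
    with t on its right, where the last row of the rectangle stays bare, and
    r' below it ([transfer]).

    The row counts add up to a + e, the widths stay at most m a because t lies
    under the staircase, and the sizes agree because both rectangles have
    m k (a + 1 - k) cells.  The bare row is the first row in which the image
    reaches the staircase, so the image determines k ([ledge_transfer]), hence
    t and r', hence p ([transfer_inj]). *)

(** * Gaussian binomials count the partitions in a box *)

Lemma qffact_mulB (c d : nat) :
  qffact (c + d) c * qffact d d = qffact (c + d) (c + d).
Proof.
rewrite /qffact [RHS]big_split_ord /=; congr (_ * _).
by apply: eq_bigr => i _; rewrite subnDl.
Qed.

Lemma qbin_sym (c d : nat) : qbin (c + d) c = qbin (c + d) d.
Proof.
have nz k : qffact k k != 0 by rewrite monic_neq0 ?qffact_monic.
apply: (mulIf (nz c)); apply: (mulIf (nz d)).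
by rewrite qbinM qffact_mulB mulrAC qbinM addnC qffact_mulB.
Qed.

(** The form of Pascal's rule that splits off a largest part equal to n - k. *)
Lemma qbin_pascal (n k : nat) : (k <= n)%N ->
  qbin n.+1 k.+1 = qbin n k.+1 + 'X^(n - k) * qbin n k.
Proof.
move=> kn; have nz : qffact k.+1 k.+1 != 0 by rewrite monic_neq0 ?qffact_monic.
apply: (mulIf nz); rewrite mulrDl !qbinM !qffactSS -mulrA [qbin n k * _]mulrCA.
rewrite qbinM mulrA [qffact n k.+1]big_ord_recr /= -/(qffact n k).
rewrite [qffact n k * _]mulrC -mulrDl -qintD; congr (qint _ * _).
by rewrite addnS subnK.
Qed.

Lemma qbin0 (n : nat) : qbin n 0 = 1.
Proof. by have := qbinM n 0; rewrite /qffact !big_ord0 mulr1. Qed.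

Lemma qbinn (n : nat) : qbin n n = 1.
Proof.
have nz : qffact n n != 0 by rewrite monic_neq0 ?qffact_monic.
by apply: (mulIf nz); rewrite qbinM mul1r.
Qed.

(** Partitions are padded with zeros to exactly a parts, so that those with at
    most a parts become the weakly decreasing sequences of size a. *)
Fixpoint box (a b : nat) : seq (seq nat) :=
  if a is a'.+1 then [seq x :: p | x <- iota 0 b.+1, p <- box a' x]
  else [:: [::]].

Lemma boxS (a b : nat) :
  box a.+1 b = [seq x :: p | x <- iota 0 b.+1, p <- box a x].
Proof. by []. Qed.

Lemma mem_box (a b : nat) (p : seq nat) :
  (p \in box a b) = (size p == a) && pairwise geq (b :: p).
Proof.
elim: a b p => [|a IHa] b p; first by case: p.
rewrite boxS; apply/allpairsPdep/idP => [[x [s [xb sx ->]]]|].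
  move: xb sx; rewrite mem_iota IHa /= => xb /andP[/eqP-> /andP[sx ->]].
  rewrite eqxx sx !andbT /=; apply/andP; split; first by lia.
  by apply: sub_all sx => y /=; lia.
case: p => [|x s] // /andP[sz /andP[/andP[xb _] xs]].
exists x, s; rewrite mem_iota IHa -eqSS sz; split => //; lia.
Qed.

Lemma size_box (a b : nat) (p : seq nat) : p \in box a b -> size p = a.
Proof. by rewrite mem_box => /andP[/eqP]. Qed.

Lemma pairwise_box (a b : nat) (p : seq nat) : p \in box a b -> pairwise geq p.
Proof. by rewrite mem_box => /and3P[]. Qed.

Lemma sub_box (a b c : nat) (p : seq nat) :
  (b <= c)%N -> p \in box a b -> p \in box a c.
Proof.
move=> bc; rewrite !mem_box /= => /and3P[-> ub ->]; rewrite andbT.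
by apply: sub_all ub => x /= /leq_trans->.
Qed.

Lemma box_uniq (a b : nat) : uniq (box a b).
Proof.
elim: a b => // a IHa b; rewrite boxS.
apply: (@allpairs_uniq_dep _ (fun=> seq nat) _ (fun x p => x :: p)).
- exact: iota_uniq.
- by move=> x _; exact: IHa.
- by move=> [x s] [y t] _ _ /= [-> ->].
Qed.

Lemma qbin_box (a b : nat) :
  qbin (a + b) a = \sum_(p <- box a b) 'X^(sumn p).
Proof.
have sum_boxS a' b' : \sum_(p <- box a'.+1 b') 'X^(sumn p) =
    \sum_(0 <= x < b'.+1) 'X^x * \sum_(p <- box a' x) 'X^(sumn p) :> {poly int}.
  rewrite boxS big_allpairs_dep /index_iota subn0; apply: eq_bigr => x _.
  by rewrite big_distrr; apply: eq_bigr => p _; rewrite exprD.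
elim: a b => [|a IHa] b; first by rewrite qbin0 big_seq1 expr0.
elim: b => [|b IHb].
  by rewrite addn0 qbinn sum_boxS big_nat1 expr0 mul1r -IHa addn0 qbinn.
rewrite sum_boxS big_nat_recr //= -sum_boxS -IHb -IHa addnS qbin_pascal ?leq_addr //.
  by rewrite addSnnS addKn.
by lia.
Qed.

(** * Trading the height of a box for its width *)

Local Open Scope nat_scope.

(** With indices from 0, row i of the staircase has length m (size p - i); the
    value 0 means that p lies strictly under the staircase. *)
Definition ledge (m : nat) (p : seq nat) : nat :=
  \max_(i < size p | m * (size p - i) <= nth 0 p i) i.+1.

(** Here e is the excess of the number of rows of the target box over the size
    of p.  The recursive call has k rows to turn into k + e', whatever k is, so
    the excess drops by exactly one and the recursion is structural. *)
Fixpoint transfer (m e : nat) (p : seq nat) : seq nat :=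
  if e is e'.+1 then
    let k := ledge m p in
    [seq m * k + x | x <- drop k p] ++
    (m * k) :: transfer m e' [seq x - m * (size p - k).+1 | x <- take k p]
  else p.

Lemma ledge_leq (m : nat) (p : seq nat) : (ledge m p <= size p).
Proof. by apply/bigmax_leqP => i _; exact: ltn_ord. Qed.

(** The last row that reaches the staircase has the required length, and the
    rows above it are at least as long. *)
Lemma ledge_take (m : nat) (p : seq nat) : pairwise geq p ->
  all (leq (m * (size p - ledge m p).+1)) (take (ledge m p) p).
Proof.
move=> dec; have [->|k_gt0] := posnP (ledge m p); first by rewrite take0.
have [i [Ei kE]] : exists i, (m * (size p - i) <= nth 0 p i) /\ ledge m p = i.+1.
  move: k_gt0; rewrite /ledge; elim/big_ind: _ => // [x y IHx IHy|i Hi _].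
    by case: (leqP y x) => xy; rewrite ?(maxn_idPl _) ?(maxn_idPr (ltnW _)).
  by exists i.
have kp := ledge_leq m p.
apply/(all_nthP 0)=> j; rewrite size_takel // => jk; rewrite nth_take //.
move/(pairwiseP 0): dec => dec.
apply: (@leq_trans (nth 0 p i)); first by move: Ei; congr leq; congr muln; lia.
by have [->//|ji] := eqVneq j i; apply: dec; rewrite ?inE; lia.
Qed.

Lemma ledge_drop (m : nat) (p : seq nat) (i : nat) :
  (ledge m p <= i < size p) -> (nth 0 p i < m * (size p - i)).
Proof.
case/andP=> ki ip; rewrite ltnNge; apply/negP => le_p.
have : (i < ledge m p).
  exact: (@leq_bigmax_cond _ (fun j : 'I_(size p) => m * (size p - j) <= nth 0 p j)
    (fun j => j.+1) (Ordinal ip)).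
by rewrite ltnNge ki.
Qed.

(** The width m (size p + e + 1) of the box exceeds the width of the rectangle
    by m (k + e): the part to the right of the rectangle meets the hypothesis of
    the recursion, with k rows and the excess e. *)
Lemma box_take (m e : nat) (p : seq nat) (k := ledge m p) :
  p \in box (size p) (m * (size p + e.+1)) ->
  [seq x - m * (size p - k).+1 | x <- take k p] \in box k (m * (k + e)).
Proof.
rewrite mem_box eqxx /= => /andP[/allP ub dec].
have kp : (k <= size p) := ledge_leq m p.
rewrite mem_box size_map size_takel // eqxx /= all_map.
apply/andP; split.
  apply/allP => x /mem_take/ub /=.
  have -> : (m * (size p + e.+1) = m * (k + e) + m * (size p - k).+1).
    by rewrite -mulnDr; congr muln; lia.
  by rewrite leq_subLR addnC.
have : pairwise geq (take k p).
  by move: dec; rewrite -{1}(cat_take_drop k p) pairwise_cat => /and3P[].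
by rewrite pairwise_map; apply: sub_pairwise => x y /=; exact: leq_sub2r.
Qed.

Lemma sumn_transfer (m e : nat) (p : seq nat) :
  p \in box (size p) (m * (size p + e)) -> sumn (transfer m e p) = sumn p.
Proof.
elim: e p => //= e IHe p p_box; set k := ledge m p.
have kp : (k <= size p) := ledge_leq m p.
have q_box := box_take _ _ _ p_box; rewrite -/k in q_box.
have dec := pairwise_box _ _ _ p_box.
have shiftD c s : sumn [seq c + x | x <- s] = (c * size s + sumn s).
  by elim: s => [|x s IHs] /=; lia.
have shiftB c s : all (leq c) s ->
    (sumn [seq x - c | x <- s] + c * size s) = sumn s.
  by elim: s => [|x s IHs] /= => [_|/andP[cx /IHs]]; lia.
rewrite sumn_cat /= IHe; last by rewrite size_map size_takel.
rewrite -[in RHS](cat_take_drop k p) [RHS]sumn_cat.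
rewrite -(shiftB _ _ (ledge_take _ _ dec)) shiftD size_takel // size_drop -/k.
set A := sumn _; set B := sumn _; nia.
Qed.

Lemma transfer_box (m e : nat) (p : seq nat) :
  p \in box (size p) (m * (size p + e)) ->
  transfer m e p \in box (size p + e) (m * size p).
Proof.
elim: e p => [|e IHe] p p_box; first by rewrite addn0 in p_box *.
rewrite [transfer _ _ _]/=; set k := ledge m p.
have kp : (k <= size p) := ledge_leq m p.
have q_box := box_take _ _ _ p_box; rewrite -/k in q_box.
set q := (X in transfer m e X); rewrite -/q in q_box.
have sz_q : size q = k by rewrite size_map size_takel.
have := IHe q; rewrite sz_q => /(_ q_box); set r := transfer m e q.
rewrite mem_box => /andP[/eqP sz_r] /= /andP[ub_r dec_r].
have dec : pairwise geq (drop k p).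
  have := pairwise_box _ _ _ p_box.
  by rewrite -{1}(cat_take_drop k p) pairwise_cat => /and3P[].
rewrite mem_box size_cat /= size_map size_drop sz_r -addSnnS addnA addnS.
rewrite addSn subnK // eqxx /= all_cat pairwise_cat /= ub_r dec_r !andbT.
have ub_kp : all (geq (m * size p)) [seq m * k + x | x <- drop k p].
  rewrite all_map; apply/(all_nthP 0) => i; rewrite size_drop nth_drop => ip /=.
  have := @ledge_drop m p (k + i); rewrite -/k.
  have : (m * size p = m * k + m * i + m * (size p - (k + i))).
    by rewrite -!mulnDr; congr muln; lia.
  by move=> ->; lia.
rewrite -!andbA; apply/and5P; split => //.
- by rewrite leq_mul2l kp orbT.
- by apply: sub_all ub_r => x /= xk; apply: leq_trans xk _; rewrite leq_mul2l kp orbT.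
- rewrite allrel_consr all_map; apply/andP; split.
    by apply/allP => x _ /=; rewrite leq_addr.
  apply/allrelP => _ y /mapP[x _ ->] /(allP ub_r) /= yk.
  by apply: leq_trans yk _; rewrite leq_addr.
- by rewrite pairwise_map; apply: sub_pairwise dec => x y /=; rewrite leq_add2l.
Qed.

(** Row size p - k of the image is the bare row m k, exactly as long as the
    staircase, whereas the rows before it lie strictly under the staircase.  Two
    images with different values of k would thus disagree in the earlier of
    their bare rows. *)
Lemma ledge_transfer (m e : nat) (p q : seq nat) : size p = size q ->
  transfer m e.+1 p = transfer m e.+1 q -> ledge m p = ledge m q.
Proof.
wlog lt_pq : p q / (ledge m p < ledge m q) => [IH|] sz eq_t.
  have [/IH|/IH|//] := ltngtP (ledge m p) (ledge m q); first exact.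
  by move=> /(_ (esym sz) (esym eq_t)).
have kq := ledge_leq m q; have := congr1 (nth 0 ^~ (size q - ledge m q)) eq_t.
rewrite /= !nth_cat !size_map !size_drop ltnn subnn /= sz.
rewrite ltn_sub2l ?(leq_trans lt_pq) // (nth_map 0) ?size_drop ?sz; last by lia.
rewrite nth_drop => nthE.
have := @ledge_drop m p (ledge m p + (size q - ledge m q)); rewrite sz.
have : (m * ledge m q = m * ledge m p +
  m * (size q - (ledge m p + (size q - ledge m q)))).
  by rewrite -mulnDr; congr muln; lia.
by lia.
Qed.

Lemma transfer_inj (m e a : nat) :
  {in box a (m * (a + e)) &, injective (transfer m e)}.
Proof.
elim: e a => [|e IHe] a p q p_box q_box eq_t; first exact: eq_t.
have sz_p := size_box _ _ _ p_box.
have sz_q := size_box _ _ _ q_box.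
have eq_k := ledge_transfer m e _ _ (etrans sz_p (esym sz_q)) eq_t.
have kp := ledge_leq m p; have kq := ledge_leq m q.
have dec_p := pairwise_box _ _ _ p_box.
have dec_q := pairwise_box _ _ _ q_box.
have/allP p_ge := ledge_take m p dec_p; have/allP q_ge := ledge_take m q dec_q.
rewrite -sz_p in p_box; rewrite -sz_q in q_box.
have := box_take _ _ _ q_box; have := box_take _ _ _ p_box.
move: eq_t => /= /eqP; rewrite eqseq_cat; last first.
  by rewrite !size_map !size_drop eq_k sz_p sz_q.
rewrite -eq_k sz_p sz_q in kq p_ge q_ge *.
case/andP=> /eqP/(inj_map (@addnI _)) eq_drop /eqP[eq_tr] p_box' q_box'.
have {p_box' q_box'} /(_ eq_tr) eq_sub := IHe _ _ _ p_box' q_box'.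
rewrite -(cat_take_drop (ledge m p) p) -(cat_take_drop (ledge m p) q) eq_drop.
congr (_ ++ _).
(* The truncated subtraction can be undone because the first k rows are at
   least as long as the rectangle. *)
have undo s c : {in s, forall x, (c <= x)} ->
    [seq x + c | x <- [seq x - c | x <- s]] = s.
  by move=> s_ge; rewrite -map_comp map_id_in // => x /s_ge /= /subnK.
by rewrite -(undo _ _ p_ge) eq_sub undo.
Qed.

(** * Comparison of generating functions *)

Local Open Scope ring_scope.

(** The difference is the generating function of the elements of t that f
    does not reach. *)
Lemma sum_expX_sub (T : eqType) (w : T -> nat) (s t : seq T) (f : T -> T) :
    uniq s -> uniq t -> {in s &, injective f} -> {in s, forall x, f x \in t} ->
    {in s, forall x, w (f x) = w x} ->
  \sum_(x <- t) 'X^(w x) - \sum_(x <- s) 'X^(w x) \is a polyOver (@Num.nat int).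
Proof.
move=> us ut f_inj f_t wf.
have eq_im : perm_eq [seq x <- t | x \in [seq f y | y <- s]] [seq f y | y <- s].
  apply: uniq_perm => [||x]; rewrite ?filter_uniq ?map_inj_in_uniq //.
  rewrite mem_filter andb_idr // => /mapP[y ys ->]; exact: f_t.
rewrite (bigID (mem [seq f y | y <- s])) /= -big_filter (perm_big _ eq_im).
rewrite big_map (eq_big_seq (fun x => 'X^(w x))) => [|x /wf -> //].
rewrite addrC addrK; apply/polyOverP => i; rewrite coef_sum.
by under eq_bigr do rewrite coefXn; rewrite -natr_sum; exact: Num.Theory.natr_nat.
Qed.

Theorem corollary1p7 (a b c d : nat)
    (ha : (0 < a)%N) (hb : (0 < b)%N) (hc : (0 < c)%N) (hd : (0 < d)%N)
    (hle : (a * b <= c * d)%N)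
    (hmin : a = minn a (minn b (minn c d)))
    (hdvd : (a %| c)%N \/ (a %| d)%N) :
  qbin (c + d) c - qbin (a + b) a \is a polyOver (@Num.nat int).
Proof.
wlog /dvdnP[m dE] : c d hc hd hle hmin hdvd / (a %| d)%N => [IH|].
  case: (hdvd) => [a_c|]; last exact: IH.
  rewrite qbin_sym addnC; apply: IH => //; last by right.
  - by rewrite [(d * c)%N]mulnC.
  - by rewrite [minn d c]minnC.
have ac : (a <= c)%N by lia.
have le_b : (b <= m * (a + (c - a)))%N.
  by rewrite subnKC // -(leq_pmul2l ha); apply: leq_trans hle _; rewrite dE; lia.
rewrite !qbin_box; apply: (@sum_expX_sub _ _ _ _ (transfer m (c - a))).
- exact: box_uniq.
- exact: box_uniq.
- by move=> p q p_box q_box; apply: (transfer_inj m (c - a) a); exact: sub_box le_b _.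
- move=> p p_box; have sz := size_box _ _ _ p_box.
  have := transfer_box m (c - a) p; rewrite sz subnKC // dE; apply.
  by apply: sub_box p_box; rewrite -(subnKC ac).
- move=> p p_box; have sz := size_box _ _ _ p_box.
  by apply: sumn_transfer; rewrite sz; exact: sub_box p_box.
Qed.
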